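(* Let $m\ge 2$ be a natural number. There exists a prime $p$ with $m^2<p<(m+1)^2$ (i.e. Legendre's conjecture holds for $m$) if and only if there exists a leading element $q\in \mathbb{M}_T$ of the $T$-matrix with $q\in (m^4,(m+1)^4)$.
   Context: Let $p_i$ be the $i$-th prime ($p_1=2$). For $k\ge 1$ put $p(k)=p_{k+2}$, so $p(1)=5$, $p(2)=7$, etc. The $T$-matrix is the infinite matrix with entries $a(k;n)=p(k)\left(5+2\lfloor n/2\rfloor+4\lfloor (n-1)/2\rfloor\right)$ for $k,n\ge 1$. An entry $a(k;n)$ is called leading if $a(k;n)=p(k)^2$; $\mathbb{M}_T$ is the set of all leading elements of the $T$-matrix (so $\mathbb{M}_T=\{p(k)^2: k\ge1\}$). Legendre's conjecture is the assertion that for every natural $m$ there is a prime $p$ with $m^2<p<(m+1)^2$. *)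

(* Defs.v *)
From mathcomp Require Import all_boot.

Set Implicit Arguments.
Unset Strict Implicit.
Unset Printing Implicit Defensive.

Lemma ex_prime_above (m : nat) : exists p, (m < p) && prime p.
Proof. by have [p mp pp] := prime_above m; exists p; rewrite mp. Qed.

Definition next_prime (m : nat) : nat := ex_minn (ex_prime_above m).

(* Indexed from 1, so that [nth_prime 1 = 2]; [nth_prime 0 = 1] is junk. *)
Definition nth_prime (i : nat) : nat := iter i next_prime 1.

Definition T_prime (k : nat) : nat := nth_prime (k + 2).

(* Only the entries with [1 <= k] and [1 <= n] belong to the T-matrix. *)
Definition T_entry (k n : nat) : nat :=
  T_prime k * (5 + 2 * (n %/ 2) + 4 * ((n - 1) %/ 2)).

Definition T_leading (k n : nat) : Prop := T_entry k n = T_prime k ^ 2.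

Definition M_T (q : nat) : Prop :=
  exists k n, [/\ 1 <= k, 1 <= n, T_leading k n & q = T_entry k n].

(* Main.v *)
Require Import Defs.
From mathcomp Require Import all_boot zify.

(** The leading elements of the T-matrix are exactly the squares of the primes
    [p >= 5]: row [k] is [T_prime k] times the increasing sequence
    5, 7, 11, 13, ... of all integers [>= 5] prime to 6, and [T_prime k] is
    itself such an integer ([column_of_prime]), while every prime [p >= 5] heads
    some row because iterating [next_prime] skips no prime
    ([T_prime_surjective]). Squaring is strictly increasing, so a prime [p] lies
    in (m^2, (m+1)^2) if and only if [p ^ 2] lies in (m^4, (m+1)^4); the
    assumption [2 <= m] makes every prime above [m ^ 2] at least 5. *)

Lemma next_primeP (m : nat) :
  [/\ m < next_prime m, prime (next_prime m)
    & forall p, m < p -> prime p -> next_prime m <= p].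
Proof.
rewrite /next_prime; case: ex_minnP => r /andP[mr pr] rmin.
by split=> // p mp pp; apply: rmin; rewrite mp.
Qed.

Lemma next_prime_eq (m p : nat) :
    m < p -> prime p -> (forall r, m < r < p -> ~~ prime r) ->
  next_prime m = p.
Proof.
move=> mp pp gap; have [mr pr rmin] := next_primeP m.
apply/eqP; rewrite eqn_leq rmin //= leqNgt; apply/negP => rp.
by have := gap (next_prime m); rewrite mr rp pr => /(_ isT).
Qed.

Lemma nth_prime2 : nth_prime 2 = 3.
Proof.
have e1 : next_prime 1 = 2 by apply: next_prime_eq => // r; lia.
by rewrite /nth_prime /= e1; apply: next_prime_eq => // r; lia.
Qed.

Lemma T_prime_prime (k : nat) : prime (T_prime k).
Proof. by rewrite /T_prime addn2 /nth_prime iterS; case: (next_primeP (nth_prime k.+1)). Qed.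

(** By minimality [next_prime] cannot jump over [p], so the sequence, once below
    [p], climbs until it hits [p]; the distance to [p] decreases strictly. *)
Lemma nth_prime_reaches (p i : nat) :
  prime p -> nth_prime i < p -> exists2 j, i < j & nth_prime j = p.
Proof.
move=> pp; have [d] := ubnP (p - nth_prime i).
elim: d i => // d IHd i led ip.
have [lt_next _ /(_ p ip pp)] := next_primeP (nth_prime i).
rewrite -[next_prime _]/(nth_prime i.+1) in lt_next *.
rewrite leq_eqVlt => /predU1P[<- | lt_p]; first by exists i.+1.
have [||j ij <-] := IHd i.+1; [lia | by [] | by exists j; first exact: ltnW].
Qed.

Lemma T_prime_surjective (p : nat) :
  prime p -> 4 < p -> exists2 k, 1 <= k & T_prime k = p.
Proof.
move=> pp p4.
have [|j j2 <-] := @nth_prime_reaches p 2 pp; first by rewrite nth_prime2; lia.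
by exists (j - 2); [lia | rewrite /T_prime subnK // ltnW].
Qed.

(** A prime [p >= 5] is 1 or 5 modulo 6; the column factor is [6 * j + 1] at
    [n = 2 * j] and [6 * j + 5] at [n = 2 * j + 1]. *)
Lemma column_of_prime (p : nat) :
    prime p -> 4 < p ->
  exists2 n, 1 <= n & 5 + 2 * (n %/ 2) + 4 * ((n - 1) %/ 2) = p.
Proof.
move=> pp p4.
have /negPf n2 : ~~ (2 %| p) by rewrite dvdn_prime2 //; lia.
have /negPf n3 : ~~ (3 %| p) by rewrite dvdn_prime2 //; lia.
have [p1 | p5] : p %% 6 = 1 \/ p %% 6 = 5 by lia.
  by exists (2 * (p %/ 6)); lia.
by exists (2 * (p %/ 6) + 1); lia.
Qed.

Lemma M_T_prime_square (p : nat) : prime p -> 4 < p -> M_T (p ^ 2).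
Proof.
move=> pp p4; have [k k1 kp] := T_prime_surjective _ pp p4.
have [n n1 np] := column_of_prime _ pp p4.
by exists k, n; rewrite /T_leading /T_entry np kp.
Qed.

Lemma M_T_is_prime_square (q : nat) : M_T q -> exists2 p, prime p & q = p ^ 2.
Proof.
by case=> k [n [_ _ lead ->]]; exists (T_prime k); first exact: T_prime_prime.
Qed.

Lemma square_between (m p : nat) :
  (m ^ 4 < p ^ 2 < (m + 1) ^ 4) = (m ^ 2 < p < (m + 1) ^ 2).
Proof. by rewrite -[4]/(2 * 2) !expnM !ltn_sqr. Qed.

Theorem mainTheorem1 (m : nat) (hm : 2 <= m) :
  (exists p : nat, prime p /\ m ^ 2 < p < (m + 1) ^ 2) <->
  (exists q : nat, M_T q /\ m ^ 4 < q < (m + 1) ^ 4).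
Proof.
split=> [[p [pp mp]] | [q [/M_T_is_prime_square[p pp ->]]]].
  exists (p ^ 2); rewrite square_between; split=> //.
  apply: M_T_prime_square => //; case/andP: mp => mp _.
  by apply: leq_ltn_trans mp; rewrite -[4]/(2 ^ 2) leq_sqr.
by rewrite square_between; exists p.
Qed.
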